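(* Let $G$ be a subgroup of $\mathcal{S}_3$ and let $(V,\Delta,\beta)$ be a $G$-Hom-coalgebra over $\mathbb{K}$. Then the dual vector space $V^\star$ carries a $G$-Hom-associative algebra structure $(V^\star,\Delta^\star,\beta^\star)$, where $\Delta^\star$ and $\beta^\star$ are the transpose maps.
   Context: $\mathbb{K}$ is an algebraically closed field of characteristic $0$. A Hom-coalgebra is a triple $(V,\Delta,\beta)$ where $V$ is a $\mathbb{K}$-vector space and $\Delta:V\to V\otimes V$, $\beta:V\to V$ are linear maps. Its $\beta$-coassociator is $\mathbf{c}_\beta(\Delta)=(\Delta\otimes\beta)\circ\Delta-(\beta\otimes\Delta)\circ\Delta$. For a vector space $W$ and $\sigma\in\mathcal{S}_3$ (the symmetric group), $\Phi_\sigma:W^{\otimes 3}\to W^{\otimes 3}$ is the linear map $\Phi_\sigma(x_1\otimes x_2\otimes x_3)=x_{\sigma^{-1}(1)}\otimes x_{\sigma^{-1}(2)}\otimes x_{\sigma^{-1}(3)}$, and $(-1)^{\epsilon(\sigma)}$ is the signature of $\sigma$. For a subgroup $G\le\mathcal{S}_3$, a Hom-coalgebra $(V,\Delta,\beta)$ is a $G$-Hom-coalgebra if $\sum_{\sigma\in G}(-1)^{\epsilon(\sigma)}\Phi_\sigma\circ\mathbf{c}_\beta(\Delta)=0$. A $G$-Hom-associative algebra is a triple $(W,\mu,\alpha)$ with $W$ a $\mathbb{K}$-vector space and $\mu:W\otimes W\to W$, $\alpha:W\to W$ linear maps such that $\sum_{\sigma\in G}(-1)^{\epsilon(\sigma)}a_{\alpha,\mu}\circ\Phi_\sigma=0$,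 where $a_{\alpha,\mu}=\mu\circ(\mu\otimes\alpha)-\mu\circ(\alpha\otimes\mu)$. $V^\star=\mathrm{Hom}(V,\mathbb{K})$. The multiplication written $\Delta^\star$ on $V^\star$ is the transpose of $\Delta$ composed with the canonical map $V^\star\otimes V^\star\to(V\otimes V)^\star$; explicitly $\Delta^\star(f_1\otimes f_2)=\mu_{\mathbb{K}}\circ(f_1\otimes f_2)\circ\Delta$, with $\mu_{\mathbb{K}}$ the multiplication of $\mathbb{K}$. Also $\beta^\star(f)=f\circ\beta$. *)

(* Defs.v *)
From HB Require Import structures.
From mathcomp Require Import all_boot all_algebra all_fingroup.
From mathcomp Require Import sesquilinear ring_quotient boolp.
From mathcomp Require Import finmap monalg.

Set Implicit Arguments.
Unset Strict Implicit.
Unset Printing Implicit Defensive.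

Import GRing.Theory.

Local Open Scope ring_scope.
Local Open Scope quotient_scope.

(* MathComp has no tensor product of arbitrary (possibly infinite-dimensional)
   vector spaces, so we construct it: U ⊗ V is the free vector space
   {malg K[(U * V)%type]} on the set U * V, modulo the subspace spanned by the
   bilinearity relations. *)
Section TensorProduct.
Context (K : fieldType) (U V : lmodType K).

Inductive tensor_rel : {malg K[(U * V)%type]} -> Prop :=
| TensorRelLeft a u u' v :
    tensor_rel (<< (a *: u + u', v) >> - (a *: << (u, v) >> + << (u', v) >>))
| TensorRelRight a u v v' :
    tensor_rel (<< (u, a *: v + v') >> - (a *: << (u, v) >> + << (u, v') >>))
| TensorRel0 : tensor_rel 0
| TensorRelP a x y : tensor_rel x -> tensor_rel y -> tensor_rel (a *: x + y).

Definition tensor_relb : {pred {malg K[(U * V)%type]}} :=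
  fun x => `[< tensor_rel x >].

Fact tensor_relb_zmod_closed : zmod_closed tensor_relb.
Proof.
split=> [|x y /asboolP xP /asboolP yP]; apply/asboolP; first exact: TensorRel0.
by rewrite addrC -scaleN1r; apply: TensorRelP.
Qed.

HB.instance Definition _ :=
  GRing.isZmodClosed.Build {malg K[(U * V)%type]} tensor_relb tensor_relb_zmod_closed.

Definition tensor := Quotient.quot tensor_relb.

HB.instance Definition _ := GRing.Zmodule.on tensor.

Definition tensor_pi (x : {malg K[(U * V)%type]}) : tensor :=
  \pi_(Quotient.quot tensor_relb) x.
Definition tensor_repr (x : tensor) : {malg K[(U * V)%type]} :=
  @generic_quotient.repr _ (Quotient.quot tensor_relb) x.

Lemma tensor_reprK : cancel tensor_repr tensor_pi.
Proof. by move=> x; exact: reprK. Qed.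

Lemma tensor_pi_eqP x y : tensor_pi x = tensor_pi y <-> tensor_rel (x - y).
Proof.
rewrite /tensor_pi; split=> [/eqP|H].
  by rewrite -Quotient.idealrBE => /asboolP.
by apply/eqP; rewrite -Quotient.idealrBE; apply/asboolP.
Qed.

Lemma tensor_piD : {morph tensor_pi : x y / x + y}.
Proof. by move=> x y; exact: raddfD. Qed.

Lemma tensor_rel_scale a x : tensor_rel x -> tensor_rel (a *: x).
Proof. by move=> xP; rewrite -[_ *: _]addr0; apply/TensorRelP/TensorRel0. Qed.

Definition tensor_scale (a : K) (x : tensor) : tensor :=
  tensor_pi (a *: tensor_repr x).

Lemma tensor_piZ a x : tensor_pi (a *: x) = tensor_scale a (tensor_pi x).
Proof.
apply/tensor_pi_eqP; rewrite -scalerBr; apply: tensor_rel_scale.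
by apply/tensor_pi_eqP; rewrite tensor_reprK.
Qed.

Fact tensor_scaleA a b x :
  tensor_scale a (tensor_scale b x) = tensor_scale (a * b) x.
Proof. by rewrite -[x]tensor_reprK -!tensor_piZ scalerA. Qed.

Fact tensor_scale1 : left_id 1 tensor_scale.
Proof. by move=> x; rewrite -[x]tensor_reprK -tensor_piZ scale1r. Qed.

Fact tensor_scaleDr : right_distributive tensor_scale +%R.
Proof.
move=> a x y; rewrite -[x]tensor_reprK -[y]tensor_reprK -tensor_piD.
by rewrite -!tensor_piZ -tensor_piD scalerDr.
Qed.

Fact tensor_scaleDl x : {morph tensor_scale^~ x : a b / a + b}.
Proof.
by move=> a b; rewrite -[x]tensor_reprK -!tensor_piZ -tensor_piD scalerDl.
Qed.

HB.instance Definition _ := GRing.Zmodule_isLmodule.Build K tensor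
  tensor_scaleA tensor_scale1 tensor_scaleDr tensor_scaleDl.

Fact tensor_pi_linear : linear tensor_pi.
Proof. by move=> a x y; rewrite tensor_piD tensor_piZ. Qed.

HB.instance Definition _ := GRing.isLinear.Build K {malg K[(U * V)%type]} tensor
  _ tensor_pi tensor_pi_linear.

Definition tens (u : U) (v : V) : tensor := tensor_pi << (u, v) >>.

Fact tens_is_bilinear : bilinear_for *:%R *:%R tens.
Proof.
split=> [v|u] a x y; rewrite /tens -linearP; apply/tensor_pi_eqP.
  exact: TensorRelLeft.
exact: TensorRelRight.
Qed.

HB.instance Definition _ := bilinear_isBilinear.Build K U V tensor *:%R *:%R
  tens tens_is_bilinear.

End TensorProduct.

Notation "U ⊗ V" := (tensor U V) (at level 40, left associativity).
Notation "u *t v" := (tens u v) (at level 40, left associativity) : ring_scope.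

(* The universal property: tens_lift f is the linear map U ⊗ V -> W induced by
   a bilinear map f, by tens_lift_linear, tens_liftE and eq_tensor.  It is
   meaningless if f is not bilinear. *)
Section UniversalProperty.
Context (K : fieldType) (U V W : lmodType K).
Implicit Types (f : U -> V -> W) (x : {malg K[(U * V)%type]}).

Definition malg_lift f x : W := \sum_(k <- msupp x) x@_k *: f k.1 k.2.

Definition tens_lift f (x : U ⊗ V) : W := malg_lift f (tensor_repr x).

Lemma malg_liftEw f x (d : {fset (U * V)%type}) : (msupp x `<=` d)%fset ->
  malg_lift f x = \sum_(k <- d) x@_k *: f k.1 k.2.
Proof.
move=> le_xd; rewrite /malg_lift.
rewrite (big_fset_incl _ le_xd) // => k _ /mcoeff_outdom ->.
by rewrite scale0r.
Qed.

Lemma malg_liftU f u v : malg_lift f << (u, v) >> = f u v.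
Proof.
rewrite (malg_liftEw _ msuppU_le) big_seq_fset1 mcoeffUU.
by rewrite scale1r.
Qed.

Lemma malg_lift_linear f : linear (malg_lift f).
Proof.
move=> a x y; pose d := (msupp x `|` msupp y)%fset.
have le_xd : (msupp x `<=` d)%fset by apply: fsubsetUl.
have le_yd : (msupp y `<=` d)%fset by apply: fsubsetUr.
have le_sd : (msupp (a *: x + y) `<=` d)%fset.
  apply: fsubset_trans (msuppD_le _ _) _; rewrite fsubUset le_yd andbT.
  exact: fsubset_trans (msuppZ_le _ _) le_xd.
rewrite !(@malg_liftEw _ _ d) // scaler_sumr -big_split /=.
by apply: eq_bigr => k _; rewrite mcoeffD mcoeffZ scalerDl scalerA.
Qed.

HB.instance Definition _ f := GRing.isLinear.Build K {malg K[(U * V)%type]} W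
  _ (malg_lift f) (malg_lift_linear f).

Lemma malg_lift_rel f x : bilinear_for *:%R *:%R f ->
  tensor_rel x -> malg_lift f x = 0.
Proof.
move=> [fl fr]; elim=> [a u u' v|a u v v'||a y z _ Hy _ Hz].
- by rewrite linearB linearP /= !malg_liftU (fl v) subrr.
- by rewrite linearB linearP /= !malg_liftU (fr u) subrr.
- by rewrite linear0.
- by rewrite linearP /= Hy Hz scaler0 addr0.
Qed.

Lemma tens_lift_pi f x : bilinear_for *:%R *:%R f ->
  tens_lift f (tensor_pi x) = malg_lift f x.
Proof.
move=> bf; apply/eqP; rewrite -subr_eq0 -linearB; apply/eqP.
by apply: malg_lift_rel bf _; apply/tensor_pi_eqP; rewrite tensor_reprK.
Qed.

Lemma tens_lift_linear f : bilinear_for *:%R *:%R f -> linear (tens_lift f).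
Proof.
move=> bf a x y; rewrite -[x]tensor_reprK -[y]tensor_reprK -linearP.
by rewrite !tens_lift_pi // linearP.
Qed.

Lemma tens_liftE f u v : bilinear_for *:%R *:%R f -> tens_lift f (u *t v) = f u v.
Proof. by move=> bf; rewrite tens_lift_pi // malg_liftU. Qed.

Lemma tens_liftP a f g h (x : U ⊗ V) :
  (forall u v, h u v = a *: f u v + g u v) ->
  tens_lift h x = a *: tens_lift f x + tens_lift g x.
Proof.
move=> hE; rewrite /tens_lift /malg_lift scaler_sumr -big_split /=.
apply: eq_bigr => k _; rewrite hE scalerDr !scalerA.
by rewrite [a * _]mulrC.
Qed.

Lemma eq_tensor (g h : {linear U ⊗ V -> W}) :
  (forall u v, g (u *t v) = h (u *t v)) -> g =1 h.
Proof.
move=> gh x; rewrite -[x]tensor_reprK [tensor_repr x]monalgE !linear_sum.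
apply: eq_bigr => -[u v] _.
have -> : << (tensor_repr x)@_(u, v) *g (u, v) >>
  = (tensor_repr x)@_(u, v) *: << (u, v) >> :> {malg K[(U * V)%type]}.
  by apply/malgP => k; rewrite mcoeffZ !mcoeffU mulr_natr.
by rewrite !linearZ /=; congr (_ *: _); apply: gh.
Qed.

End UniversalProperty.

Section TensorMaps.
Context (K : fieldType).

Section Map.
Context (U V U' V' : lmodType K).
Context (f : {linear U -> U'}) (g : {linear V -> V'}).

Definition tensor_map : U ⊗ V -> U' ⊗ V' := tens_lift (fun u v => f u *t g v).

Fact tensor_map_bilinear : bilinear_for *:%R *:%R (fun u v => f u *t g v).
Proof. by split=> [v|u] a x y; rewrite linearP ?linearPl ?linearPr. Qed.

HB.instance Definition _ := GRing.isLinear.Build K (U ⊗ V) (U' ⊗ V')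
  _ tensor_map (tens_lift_linear tensor_map_bilinear).

Lemma tensor_mapE u v : tensor_map (u *t v) = f u *t g v.
Proof. exact: tens_liftE tensor_map_bilinear. Qed.
End Map.

Section Associator.
Context (U V W : lmodType K).

Definition tensorA : U ⊗ V ⊗ W -> U ⊗ (V ⊗ W) :=
  tens_lift (fun x w => tens_lift (fun u v => u *t (v *t w)) x).

Fact tensorA_bilinear2 (w : W) :
  bilinear_for *:%R *:%R (fun (u : U) (v : V) => u *t (v *t w)).
Proof. by split=> [v|u] a x y; rewrite !(linearPl, linearPr). Qed.

Fact tensorA_bilinear : bilinear_for *:%R *:%R
  (fun (x : U ⊗ V) (w : W) => tens_lift (fun u v => u *t (v *t w)) x).
Proof.
split=> [w|x] a y z; first exact: tens_lift_linear (tensorA_bilinear2 w) _ _ _.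
by apply: tens_liftP => u v; rewrite !linearPr.
Qed.

HB.instance Definition _ := GRing.isLinear.Build K (U ⊗ V ⊗ W) (U ⊗ (V ⊗ W))
  _ tensorA (tens_lift_linear tensorA_bilinear).

Lemma tensorAE u v w : tensorA (u *t v *t w) = u *t (v *t w).
Proof.
rewrite /tensorA (tens_liftE _ _ tensorA_bilinear).
exact: tens_liftE (tensorA_bilinear2 w).
Qed.

Definition tensorAi : U ⊗ (V ⊗ W) -> U ⊗ V ⊗ W :=
  tens_lift (fun u => tens_lift (fun v w => u *t v *t w)).

Fact tensorAi_bilinear2 (u : U) :
  bilinear_for *:%R *:%R (fun (v : V) (w : W) => u *t v *t w).
Proof. by split=> [v|w] a x y; rewrite !(linearPl, linearPr). Qed.

Fact tensorAi_bilinear : bilinear_for *:%R *:%R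
  (fun u : U => tens_lift (fun (v : V) (w : W) => u *t v *t w)).
Proof.
split=> [x|u] a y z; last exact: tens_lift_linear (tensorAi_bilinear2 u) _ _ _.
by apply: tens_liftP => v w; rewrite !linearPl.
Qed.

HB.instance Definition _ := GRing.isLinear.Build K (U ⊗ (V ⊗ W)) (U ⊗ V ⊗ W)
  _ tensorAi (tens_lift_linear tensorAi_bilinear).

Lemma tensorAiE u v w : tensorAi (u *t (v *t w)) = u *t v *t w.
Proof.
rewrite /tensorAi (tens_liftE _ _ tensorAi_bilinear).
exact: tens_liftE (tensorAi_bilinear2 u).
Qed.
End Associator.

(* The triple tensor power of W is W ⊗ W ⊗ W = (W ⊗ W) ⊗ W; the isomorphisms
   tensorA and tensorAi are the usual identification with W ⊗ (W ⊗ W). *)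
Section Permutation.
Context (W : lmodType K).

Definition tens3 (x : 'I_3 -> W) : W ⊗ W ⊗ W := x 0 *t x 1 *t x 2.

Definition Phi (s : 'S_3) : W ⊗ W ⊗ W -> W ⊗ W ⊗ W :=
  tens_lift (fun p x2 => tens_lift (fun x0 x1 =>
    tens3 (fun i => tnth [tuple x0; x1; x2] ((s^-1)%g i))) p).

Section PhiLinear.
Variable s : 'S_3.
Let t x0 x1 x2 := tens3 (fun i => tnth [tuple x0; x1; x2] ((s^-1)%g i)).

Fact perm3P (q : 'S_3) (P : 'I_3 -> 'I_3 -> 'I_3 -> Prop) :
  P 0 1 2 -> P 0 2 1 -> P 1 0 2 -> P 1 2 0 -> P 2 0 1 -> P 2 1 0 ->
  P (q 0) (q 1) (q 2).
Proof.
have i3 (i : 'I_3) : [\/ i = 0, i = 1 | i = 2].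
  by case: i => [] [|[|[|//]]] ilt;
    [constructor 1|constructor 2|constructor 3]; apply: val_inj.
have inj (i j : 'I_3) : i != j -> q i <> q j by move=> /eqP ij /perm_inj.
have n01 := @inj 0 1 isT; have n02 := @inj 0 2 isT; have n12 := @inj 1 2 isT.
by case: (i3 (q 0)) n01 n02 => ->; case: (i3 (q 1)) n12 => ->;
  case: (i3 (q 2)) => ->.
Qed.

Fact tens3_trilinear :
  [/\ forall x1 x2, linear (fun x0 => t x0 x1 x2),
      forall x0 x2, linear (fun x1 => t x0 x1 x2)
    & forall x0 x1, linear (fun x2 => t x0 x1 x2)].
Proof.
rewrite /t /tens3; apply: (perm3P (s^-1)%g (P := fun i j k =>
  [/\ forall x1 x2, linear (fun x0 => let y := tnth [tuple x0; x1; x2] in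
        y i *t y j *t y k),
      forall x0 x2, linear (fun x1 => let y := tnth [tuple x0; x1; x2] in
        y i *t y j *t y k)
    & forall x0 x1, linear (fun x2 => let y := tnth [tuple x0; x1; x2] in
        y i *t y j *t y k)]));
  by split=> x y a z z'; rewrite /= /tnth /= !(linearPl, linearPr).
Qed.

Fact Phi_bilinear2 x2 : bilinear_for *:%R *:%R (fun x0 x1 => t x0 x1 x2).
Proof. by case: tens3_trilinear => t0 t1 _; split=> x; [apply: t0|apply: t1]. Qed.

Fact Phi_bilinear : bilinear_for *:%R *:%R
  (fun p x2 => tens_lift (fun x0 x1 => t x0 x1 x2) p).
Proof.
split=> [x2|p] a y z; first exact: tens_lift_linear (Phi_bilinear2 x2) _ _ _.
by apply: tens_liftP => x0 x1; case: tens3_trilinear => _ _; apply.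
Qed.

HB.instance Definition _ := GRing.isLinear.Build K (W ⊗ W ⊗ W) (W ⊗ W ⊗ W)
  _ (Phi s) (tens_lift_linear Phi_bilinear).

End PhiLinear.

Lemma PhiE s (x : 'I_3 -> W) :
  Phi s (tens3 x) = tens3 (fun i => x ((s^-1)%g i)).
Proof.
rewrite /Phi {1}/tens3 (tens_liftE _ _ (Phi_bilinear s)).
rewrite (tens_liftE _ _ (Phi_bilinear2 s _)); congr tens3; apply: funext => i.
case: ((s^-1)%g i) => [] [|[|[|//]]] ilt; rewrite /tnth /=; congr x;
  exact: val_inj.
Qed.

End Permutation.

Definition mulK : K^o ⊗ K^o -> K^o := tens_lift (fun a b : K^o => a * b).

Fact mulK_bilinear : bilinear_for *:%R *:%R (fun a b : K^o => a * b : K^o).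
Proof.
split=> [v|u] a x y /=; first by rewrite mulrDl scalerAl.
by rewrite mulrDr scalerAr.
Qed.

HB.instance Definition _ := GRing.isLinear.Build K (K^o ⊗ K^o) K^o
  _ mulK (tens_lift_linear mulK_bilinear).

Lemma mulKE (a b : K^o) : mulK (a *t b) = a * b.
Proof. exact: tens_liftE mulK_bilinear. Qed.

End TensorMaps.

Section Dual.
Context (K : fieldType).

Section DualSpace.
Context (V : lmodType K).

Definition dual := {linear V -> K^o}.
HB.instance Definition _ := gen_eqMixin dual.
HB.instance Definition _ := gen_choiceMixin dual.

Lemma dualP (f g : dual) : f =1 g -> f = g.
Proof.
case: f g => [f [[fP] [fP']]] [g [[gP] [gP']]] /= /funext fg; subst g.
by rewrite (Prop_irrelevance fP gP) (Prop_irrelevance fP' gP').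
Qed.

Definition dual0 : dual := \0.
Definition dualN (f : dual) : dual := \- f.
Definition dualD (f g : dual) : dual := f \+ g.
Definition dualZ (a : K) (f : dual) : dual := a \*: f.

Fact dualDA : associative dualD.
Proof. by move=> f g h; apply: dualP => v; exact: addrA. Qed.
Fact dualDC : commutative dualD.
Proof. by move=> f g; apply: dualP => v; exact: addrC. Qed.
Fact dual0D : left_id dual0 dualD.
Proof. by move=> f; apply: dualP => v; exact: add0r. Qed.
Fact dualND : left_inverse dual0 dualN dualD.
Proof. by move=> f; apply: dualP => v; exact: addNr. Qed.
HB.instance Definition _ := GRing.isZmodule.Build dual dualDA dualDC dual0D dualND.

Fact dualZA a b f : dualZ a (dualZ b f) = dualZ (a * b) f.
Proof. by apply: dualP => v; exact: scalerA. Qed.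
Fact dual1Z : left_id 1 dualZ.
Proof. by move=> f; apply: dualP => v; exact: scale1r. Qed.
Fact dualZDr : right_distributive dualZ +%R.
Proof. by move=> a f g; apply: dualP => v; exact: scalerDr. Qed.
Fact dualZDl f : {morph dualZ^~ f : a b / a + b}.
Proof. by move=> a b; apply: dualP => v; exact: scalerDl. Qed.
HB.instance Definition _ := GRing.Zmodule_isLmodule.Build K dual
  dualZA dual1Z dualZDr dualZDl.
End DualSpace.

Section Transpose.
Context (U V : lmodType K) (h : {linear U -> V}).

Definition transpose (f : dual V) : dual U := f \o h.

Fact transpose_linear : linear transpose.
Proof. by move=> a f g; apply: dualP. Qed.

HB.instance Definition _ := GRing.isLinear.Build K (dual V) (dual U)
  _ transpose transpose_linear.
End Transpose.

Section DualTensor.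
Context (U V : lmodType K).

(* The canonical map U* ⊗ V* -> (U ⊗ V)*, f ⊗ g |-> mu_K \o (f ⊗ g) *)
Definition dual_tensor2 (f : dual U) (g : dual V) : dual (U ⊗ V) :=
  @mulK K \o tensor_map f g.

Definition dual_tensor : dual U ⊗ dual V -> dual (U ⊗ V) :=
  tens_lift dual_tensor2.

Fact dual_tensor_bilinear : bilinear_for *:%R *:%R dual_tensor2.
Proof.
split=> [g|f] a h k; apply: dualP => x /=;
rewrite -[X in _ = X]/(a *: mulK (tensor_map _ _ x) + mulK (tensor_map _ _ x));
rewrite -linearP; congr mulK; apply: tens_liftP => u v.
  exact: linearPl.
exact: linearPr.
Qed.

HB.instance Definition _ := GRing.isLinear.Build K (dual U ⊗ dual V)
  (dual (U ⊗ V)) _ dual_tensor (tens_lift_linear dual_tensor_bilinear).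

Lemma dual_tensorE f g x : dual_tensor (f *t g) x = mulK (tensor_map f g x).
Proof. by rewrite /dual_tensor (tens_liftE _ _ dual_tensor_bilinear). Qed.
End DualTensor.

Definition transpose_mul (V : lmodType K) (Delta : {linear V -> V ⊗ V}) :
  {linear dual V ⊗ dual V -> dual V} := transpose Delta \o @dual_tensor V V.

Lemma transpose_mulE (V : lmodType K) (Delta : {linear V -> V ⊗ V})
  (f g : dual V) v : transpose_mul Delta (f *t g) v = mulK (tensor_map f g (Delta v)).
Proof. exact: dual_tensorE. Qed.

End Dual.

Section HomStructures.
Context (K : fieldType) (G : {group 'S_3}).

Definition coassociator (V : lmodType K) (Delta : {linear V -> V ⊗ V})
    (beta : {linear V -> V}) (v : V) : V ⊗ V ⊗ V :=
  tensor_map Delta beta (Delta v) - tensorAi (tensor_map beta Delta (Delta v)).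

Definition is_G_Hom_coalgebra (V : lmodType K) (Delta : {linear V -> V ⊗ V})
    (beta : {linear V -> V}) : Prop :=
  forall v : V,
    \sum_(s in G) (-1) ^+ s *: Phi s (coassociator Delta beta v) = 0.

Definition associator (W : lmodType K) (mu : {linear W ⊗ W -> W})
    (alpha : {linear W -> W}) (x : W ⊗ W ⊗ W) : W :=
  mu (tensor_map mu alpha x) - mu (tensor_map alpha mu (tensorA x)).

Definition is_G_Hom_associative (W : lmodType K) (mu : {linear W ⊗ W -> W})
    (alpha : {linear W -> W}) : Prop :=
  forall x : W ⊗ W ⊗ W,
    \sum_(s in G) (-1) ^+ s *: associator mu alpha (Phi s x) = 0.

End HomStructures.

(* Main.v *)
From HB Require Import structures.
Require Import Defs.
From mathcomp Require Import all_boot all_algebra all_fingroup.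

(** Three elements f0, f1, f2 of the dual of V pair with three vectors by
    (f0 ⊗ f1 ⊗ f2, v0 ⊗ v1 ⊗ v2) |-> f0 v0 * f1 v1 * f2 v2, which is the map
    [dual_tensor3] from the triple tensor power of the dual to the dual of the
    triple tensor power.  The theorem expresses the duality, under this pairing,
    of the two defining identities:
    - the associator of the transposed operations is the transpose of the
      coassociator ([associator_transpose]).  This is the naturality of
      U* ⊗ V* -> (U ⊗ V)* ([dual_tensor_natural]) together with its
      compatibility with the reassociation of tensors ([dual_tensorA]);
    - permuting the factors of the functional by s amounts to permuting the
      factors of the argument by the inverse of s ([dual_tensor3_Phi]).
    Hence the signed sum over G of the permuted associators at x, evaluated at
    v, is the pairing of x with the signed sum of the permuted coassociators at
    v, once the group G is reindexed by inversion, which preserves signatures.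
    The latter sum vanishes by assumption.  All the identities above are linear
    in every tensor involved, so they are proved on pure tensors, where they
    concern products of three scalars ([eq_linear_tensor]). *)

Set Implicit Arguments.
Unset Strict Implicit.
Unset Printing Implicit Defensive.

Import GRing.Theory.

Local Open Scope ring_scope.

(** Identities that are linear in a tensor need checking only on pure tensors.
    Compared with [eq_tensor], this form applies to functions that are not
    packaged as linear maps, so that it can be iterated on the factors of nested
    tensor products. *)
Lemma eq_linear_tensor (K : fieldType) (U V W : lmodType K) (F G : U ⊗ V -> W) :
  linear F -> linear G -> (forall u v, F (u *t v) = G (u *t v)) -> F =1 G.
Proof.
move=> linF linG.
pose F' : {linear U ⊗ V -> W} :=
  HB.pack F (GRing.isLinear.Build K (U ⊗ V) W *:%R F linF).
pose G' : {linear U ⊗ V -> W} :=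
  HB.pack G (GRing.isLinear.Build K (U ⊗ V) W *:%R G linG).
exact: (@eq_tensor K U V W F' G').
Qed.

(** Linearity of each construction as a rewrite rule keyed on that construction:
    the generic law, tried on nested tensor maps, unifies through their
    definitions. *)
Section Linearity.
Context (K : fieldType) (U V W U' V' : lmodType K).

Lemma tensPl a (u u' : U) (v : V) : (a *: u + u') *t v = a *: (u *t v) + u' *t v.
Proof. exact: linearPl. Qed.

Lemma tensPr a (u : U) (v v' : V) : u *t (a *: v + v') = a *: (u *t v) + u *t v'.
Proof. exact: linearPr. Qed.

Lemma tensor_mapP (h : {linear U -> U'}) (k : {linear V -> V'}) a x y :
  tensor_map h k (a *: x + y) = a *: tensor_map h k x + tensor_map h k y.
Proof. exact: linearP. Qed.

Lemma tensorAP a (x y : U ⊗ V ⊗ W) :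
  tensorA (a *: x + y) = a *: tensorA x + tensorA y.
Proof. exact: linearP. Qed.

Lemma tensorAiP a (x y : U ⊗ (V ⊗ W)) :
  tensorAi (a *: x + y) = a *: tensorAi x + tensorAi y.
Proof. exact: linearP. Qed.

Lemma PhiP s a (x y : U ⊗ U ⊗ U) : Phi s (a *: x + y) = a *: Phi s x + Phi s y.
Proof. exact: linearP. Qed.

Lemma dual_tensorP a (x y : dual U ⊗ dual V) :
  dual_tensor (a *: x + y) = a *: dual_tensor x + dual_tensor y.
Proof. exact: linearP. Qed.

Lemma dual_evalPl a (f g : dual U) u : (a *: f + g) u = a *: f u + g u.
Proof. by []. Qed.

Lemma dual_evalPr a (f : dual U) u v : f (a *: u + v) = a *: f u + f v.
Proof. exact: linearP. Qed.

End Linearity.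

Definition tensor_linearP := (tensor_mapP, tensorAP, tensorAiP, PhiP,
  dual_tensorP, dual_evalPl, dual_evalPr).

Section DualTensorNaturality.
Context (K : fieldType).

Lemma dual_tensor_pure (U V : lmodType K) (f : dual U) (g : dual V) u v :
  dual_tensor (f *t g) (u *t v) = f u * g v.
Proof. by rewrite dual_tensorE tensor_mapE mulKE. Qed.

(** Naturality of the canonical map U* ⊗ V* -> (U ⊗ V)*: on pure tensors both
    sides are f (h u) * g (k v). *)
Lemma dual_tensor_natural (U V U' V' : lmodType K)
    (h : {linear U -> U'}) (k : {linear V -> V'}) (x : dual U' ⊗ dual V') y :
  dual_tensor (tensor_map (transpose h) (transpose k) x) y
  = dual_tensor x (tensor_map h k y).
Proof.
move: x; apply: eq_linear_tensor => [a x x'|a x x'|f g].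
- by rewrite !tensor_linearP.
- by rewrite !tensor_linearP.
move: y; apply: eq_linear_tensor => [a y y'|a y y'|u v].
- by rewrite !tensor_linearP.
- by rewrite !tensor_linearP.
by rewrite !tensor_mapE !dual_tensor_pure.
Qed.

Lemma tensor_map_comp (U V U' V' U'' V'' : lmodType K)
    (h : {linear U -> U'}) (k : {linear V -> V'})
    (h' : {linear U' -> U''}) (k' : {linear V' -> V''})
    (h'' : {linear U -> U''}) (k'' : {linear V -> V''}) :
  h'' =1 h' \o h -> k'' =1 k' \o k ->
  forall x, tensor_map h'' k'' x = tensor_map h' k' (tensor_map h k x).
Proof.
move=> hE kE; apply: eq_linear_tensor => [a x y|a x y|u v].
- by rewrite !tensor_linearP.
- by rewrite !tensor_linearP.
by rewrite !tensor_mapE hE kE.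
Qed.

(** Compatibility of the canonical map with reassociation; on pure tensors it is
    the associativity of the product of K. *)
Lemma dual_tensorA (U V W : lmodType K) (x : dual U ⊗ dual V ⊗ dual W)
    (y : U ⊗ (V ⊗ W)) :
  dual_tensor (tensor_map idfun (@dual_tensor K V W) (tensorA x)) y
  = dual_tensor (tensor_map (@dual_tensor K U V) idfun x) (tensorAi y).
Proof.
move: x; apply: eq_linear_tensor => [a x x'|a x x'|p h].
- by rewrite !tensor_linearP.
- by rewrite !tensor_linearP.
move: p; apply: eq_linear_tensor => [a p p'|a p p'|f g].
- by rewrite tensPl !tensor_linearP.
- by rewrite tensPl !tensor_linearP.
move: y; apply: eq_linear_tensor => [a y y'|a y y'|u q].
- by rewrite !tensor_linearP.
- by rewrite !tensor_linearP.
move: q; apply: eq_linear_tensor => [a q q'|a q q'|v w].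
- by rewrite tensPr !tensor_linearP.
- by rewrite tensPr !tensor_linearP.
by rewrite tensorAE tensorAiE !tensor_mapE !dual_tensor_pure mulrA.
Qed.

End DualTensorNaturality.

Section TransposeStructure.
Context (K : fieldType) (V : lmodType K).

Definition dual_tensor3 (x : dual V ⊗ dual V ⊗ dual V) : dual (V ⊗ V ⊗ V) :=
  dual_tensor (tensor_map (@dual_tensor K V V) idfun x).

Lemma dual_tensor3P a x y :
  dual_tensor3 (a *: x + y) = a *: dual_tensor3 x + dual_tensor3 y.
Proof. by rewrite /dual_tensor3 !tensor_linearP. Qed.

Lemma dual_tensor3_pure (f : 'I_3 -> dual V) (v : 'I_3 -> V) :
  dual_tensor3 (tens3 f) (tens3 v) = \prod_i f i (v i).
Proof.
rewrite /dual_tensor3 /tens3 tensor_mapE !dual_tensor_pure.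
rewrite !big_ord_recr big_ord0 /= mul1r.
(* The indices produced by the big operator are equal to 0, 1, 2 only up to
   their bound proofs. *)
by congr (f _ _ * f _ _ * f _ _); try congr v; apply: val_inj.
Qed.

(** Puts a pure triple tensor in the form on which [PhiE] computes. *)
Lemma tens3_tuple (W : lmodType K) (x y z : W) :
  x *t y *t z = tens3 (tnth [tuple x; y; z]).
Proof. by []. Qed.

(** On pure tensors this is the reindexing of the product of the
    f (s^-1 i) (v i) by the permutation s. *)
Lemma dual_tensor3_Phi s x y :
  dual_tensor3 (Phi s x) y = dual_tensor3 x (Phi (s^-1)%g y).
Proof.
move: x; apply: eq_linear_tensor => [a x x'|a x x'|p h].
- by rewrite PhiP dual_tensor3P.
- by rewrite dual_tensor3P.
move: p; apply: eq_linear_tensor => [a p p'|a p p'|f g].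
- by rewrite tensPl PhiP dual_tensor3P.
- by rewrite tensPl dual_tensor3P.
move: y; apply: eq_linear_tensor => [a y y'|a y y'|q w].
- by rewrite dual_evalPr.
- by rewrite PhiP dual_evalPr.
move: q; apply: eq_linear_tensor => [a q q'|a q q'|u v].
- by rewrite tensPl dual_evalPr.
- by rewrite tensPl PhiP dual_evalPr.
rewrite !tens3_tuple !PhiE [LHS]dual_tensor3_pure [RHS]dual_tensor3_pure.
rewrite (reindex_inj (@perm_inj _ s)).
by apply: eq_bigr => i _; rewrite permK invgK.
Qed.

Lemma associator_transpose (Delta : {linear V -> V ⊗ V})
    (beta : {linear V -> V}) x v :
  associator (transpose_mul Delta) (transpose beta) x v
  = dual_tensor3 x (coassociator Delta beta v).
Proof.
pose D := @dual_tensor K V V.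
(* Both operations of the transposed structure factor through the canonical
   map on two tensor factors, followed by transposes. *)
have mulDl := tensor_map_comp (h := D) (k := idfun) (h' := transpose Delta)
  (k' := transpose beta) (h'' := transpose_mul Delta) (k'' := transpose beta)
  (fun=> erefl) (fun=> erefl).
have mulDr := tensor_map_comp (h := idfun) (k := D) (h' := transpose beta)
  (k' := transpose Delta) (h'' := transpose beta) (k'' := transpose_mul Delta)
  (fun=> erefl) (fun=> erefl).
rewrite /coassociator linearB /dual_tensor3 -dual_tensorA -!dual_tensor_natural.
by rewrite /associator mulDl mulDr.
Qed.

End TransposeStructure.

Theorem proposition2p11 (K : closedFieldType) (charK0 : [pchar K] =i pred0)
    (G : {group 'S_3}) (V : lmodType K)
    (Delta : {linear V -> V ⊗ V}) (beta : {linear V -> V}) :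
  is_G_Hom_coalgebra G Delta beta ->
  is_G_Hom_associative G (transpose_mul Delta) (transpose beta).
Proof.
move=> coalgV x; apply: dualP => v.
have evalE (F : 'S_3 -> dual V) :
    (\sum_(s in G) F s) v = \sum_(s in G) F s v.
  by apply: (big_morph (fun f : dual V => f v)).
rewrite evalE -[RHS](linear0 (dual_tensor3 x)) -(coalgV v) linear_sum.
rewrite [RHS](reindex_inj invg_inj) /=.
apply: eq_big => [s|s _]; first by rewrite groupV.
rewrite linearZ /= odd_permV; congr (_ *: _).
exact: etrans (associator_transpose _ _ _ _) (dual_tensor3_Phi _ _ _).
Qed.
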